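(* Let $\widetilde\Gamma(x)=\frac1x e^{x\log 2}\prod_{k=1}^\infty\left(e^{-x/k}(1+x/k)\right)^{(-1)^{k+1}}$. For $\mathrm{Re}(x)>0$, $$\widetilde\Gamma(x)=\frac12\,\mathrm{B}\!\left(\frac x2,\frac12\right)=\frac12\int_0^1\frac{t^{\frac x2-1}}{\sqrt{1-t}}\,dt,$$ where $\mathrm{B}$ is Euler's Beta function.
   Context: In the product, for odd $k$ the factor is $e^{-x/k}(1+x/k)$ and for even $k$ it is its reciprocal; this defines a meromorphic function on $\mathbb{C}$. *)

(* Defs.v *)
From Stdlib Require Import Reals.
From Coquelicot Require Import Coquelicot.
Open Scope C_scope.

Definition Cexp (z : C) : C :=
  ((exp (Re z) * cos (Im z))%R, (exp (Re z) * sin (Im z))%R).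

(* Principal power t^s, meaningful only for t > 0: Stdlib's [ln] is 0 on
   nonpositive reals. *)
Definition Rcpow (t : R) (s : C) : C := Cexp (s * RtoC (ln t)).

(* F 1 * ... * F n *)
Fixpoint Cprod (F : nat -> C) (n : nat) : C :=
  match n with
  | O => 1
  | S m => Cprod F m * F (S m)
  end.

Definition is_Cprod_inf (F : nat -> C) (l : C) : Prop :=
  filterlim (Cprod F) eventually (locally (T := C_R_NormedModule) l).

Definition ex_Cprod_inf (F : nat -> C) : Prop :=
  exists l : C, is_Cprod_inf F l.

Definition Cprod_inf (F : nat -> C) : C :=
  iota (T := C_R_CompleteNormedModule) (is_Cprod_inf F).

(* The integral over (0, 1), improper at both ends since the integrands below
   may be singular there. *)
Definition ex_CInt01 (f : R -> C) : Prop :=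
  ex_RInt_gen (V := C_R_NormedModule) f (at_right 0%R) (at_left 1%R).

Definition CInt01 (f : R -> C) : C :=
  RInt_gen (V := C_R_CompleteNormedModule) f (at_right 0%R) (at_left 1%R).

(* Euler's integral of the first kind, for Re a > 0 and Re b > 0. *)
Definition Beta (a b : C) : C :=
  CInt01 (fun t => Rcpow t (a - 1) * Rcpow (1 - t)%R (b - 1)).

Definition tGamma_base (x : C) (k : nat) : C :=
  Cexp (- (x / RtoC (INR k))) * (1 + x / RtoC (INR k)).

(* The exponent (-1)^(k+1) is 1 for odd k and -1 for even k. *)
Definition tGamma_factor (x : C) (k : nat) : C :=
  if Nat.odd k then tGamma_base x k else / tGamma_base x k.

(* Since Coquelicot's [/ 0] is a junk value, this is only meaningful off the
   poles 0, -2, -4, ... *)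
Definition tGamma (x : C) : C :=
  1 / x * Cexp (x * RtoC (ln 2)) * Cprod_inf (tGamma_factor x).

(* Main.v *)
(* Write J(s) for the integral of t^s (1-t)^(-1/2) over (0,1), that is B(s+1, 1/2),
   and a = x/2. Integrating the derivative of t^(s+1) (1-t)^(1/2) gives
   (s+1) J(s) = (s+3/2) J(s+1). Grouping the factors 2j-1 and 2j of the product, the
   exponentials contribute exp(-x (1 - 1/2 + 1/3 - ...)) -> exp(-x log 2), and by the
   recurrence Q_N = prod_(j<=N) (1 + x/(2j-1)) / (1 + x/(2j)) satisfies
     Q_N (a+N+1/2) J(a+N) = a J(a-1) (N+1/2) J(N).
   Finally J(a+N)/J(N) -> 1: as |t^a - 1| <= |a| (1-t)/t,
   |J(a+N+1) - J(N+1)| <= |a| (J(N) - J(N+1)) = O(J(N+1)/N). *)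
Require Import Defs.
From Stdlib Require Import Reals Lra Lia.
From Coquelicot Require Import Coquelicot.
Open Scope R_scope.

(** * Improper integrals on (0, 1) *)

(** No asymptotics of the Gamma function enter: the unknown decay of J(N) cancels in J(a+N)/J(N),
    and the only integral ever evaluated is J(0) = 2, which absorbs the factor N + 1/2 at N = 0. The
    comparison runs through integers N because J(N) is real and positive there, so its kernel can
    dominate a complex one. The obstacle is convergence. The kernel is singular at 1, and also at 0
    when Re s < 0. A substitution removes the singularity at 1, but it wants t^s continuous at 0,
    that is Re s > 0. The recurrence, read as a statement about convergent integrals, then carries
    existence one unit down to Re s > -1, exactly the range of s = x/2 - 1 for Re x > 0. Grouping in
    pairs controls only the even partial products; an odd one has one more factor, which tends to
    1. *)

Lemma Riemann_sum_linear {U V : NormedModule R_AbsRing} (L : U -> V)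
  (hL : is_linear L) (f : R -> U) (ptd : SF_seq) :
  Riemann_sum (fun t => L (f t)) ptd = L (Riemann_sum f ptd).
Proof.
  induction ptd as [x0|h s IH] using SF_cons_ind.
  - change (zero = L zero). now rewrite (linear_zero L hL).
  - now rewrite !Riemann_sum_cons, IH, (linear_plus L hL), (linear_scal L hL).
Qed.

Lemma is_RInt_linear {U V : NormedModule R_AbsRing} (L : U -> V)
  (hL : is_linear L) (f : R -> U) (a b : R) (l : U) :
  is_RInt f a b l -> is_RInt (fun t => L (f t)) a b (L l).
Proof.
  intros H. unfold is_RInt in *.
  apply filterlim_ext with
    (fun ptd => L (scal (sign (b - a)) (Riemann_sum f ptd))).
  - intros ptd. now rewrite (linear_scal L hL), (Riemann_sum_linear L hL).
  - eapply filterlim_comp; [exact H|]. exact (linear_cont L l hL).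
Qed.

(** [C_R_NormedModule] has real scalars only, so a complex constant passes through the integral as a
    bounded real-linear map; real parts do so in the same way. *)
Lemma is_RInt_gen_linear {U V : NormedModule R_AbsRing} (L : U -> V)
  (hL : is_linear L) (f : R -> U) (Fa Fb : (R -> Prop) -> Prop)
  {FFa : Filter Fa} {FFb : Filter Fb} (l : U) :
  is_RInt_gen f Fa Fb l -> is_RInt_gen (fun t => L (f t)) Fa Fb (L l).
Proof.
  intros H P HP.
  assert (HP' : locally l (fun y => P (L y))) by exact (linear_cont L l hL P HP).
  specialize (H _ HP'). unfold filtermapi in *.
  revert H. apply filter_imp. intros [a b] [y [Hy Py]].
  exists (L y). split; [now apply is_RInt_linear|exact Py].
Qed.

Lemma filter_prod_01 (P : R * R -> Prop) :
  (forall a b, 0 < a -> a <= b -> b < 1 -> P (a, b)) ->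
  filter_prod (at_right 0) (at_left 1) P.
Proof.
  intros H.
  apply (Filter_prod _ _ _ (fun a => 0 < a < 1/2) (fun b => 1/2 < b < 1)).
  - exists (mkposreal (1/2) ltac:(lra)). intros y Hy Hy0.
    change (Rabs (y - 0) < 1/2) in Hy. rewrite Rabs_pos_eq in Hy; lra.
  - exists (mkposreal (1/2) ltac:(lra)). intros y Hy Hy1.
    change (Rabs (y - 1) < 1/2) in Hy. apply Rabs_def2 in Hy. lra.
  - intros a b Ha Hb. apply H; lra.
Qed.

(** The fundamental theorem applies on each compact [a, b] inside (0, 1); at the ends only one-sided
    limits of [F] matter, so [f] may be singular there. *)
Lemma is_RInt_gen_01_derive {V : CompleteNormedModule R_AbsRing}
  (F f : R -> V) (l0 l1 : V) :
  (forall t, 0 < t < 1 -> is_derive F t (f t)) ->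
  (forall t, 0 < t < 1 -> continuous f t) ->
  filterlim F (at_right 0) (locally l0) ->
  filterlim F (at_left 1) (locally l1) ->
  is_RInt_gen f (at_right 0) (at_left 1) (minus l1 l0).
Proof.
  intros HF Hf H0 H1 P HP.
  assert (HL : filterlim (fun ab => minus (F (snd ab)) (F (fst ab)))
      (filter_prod (at_right 0) (at_left 1)) (locally (minus l1 l0))).
  { refine (filterlim_comp_2 (fun ab : R * R => F (snd ab))
      (fun ab : R * R => opp (F (fst ab))) (@plus V) _ _ (filterlim_plus l1 (opp l0))).
    - apply (filterlim_comp _ _ _ snd F _ (at_left 1));
        [apply filterlim_snd|exact H1].
    - refine (filterlim_comp _ _ _ (fun ab : R * R => F (fst ab)) (@opp V) _
        (locally l0) _ _ (filterlim_opp l0)).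
      apply (filterlim_comp _ _ _ fst F _ (at_right 0));
        [apply filterlim_fst|exact H0].
  }
  specialize (HL P HP). unfold filtermap in HL.
  assert (HB := filter_prod_01 (fun ab => 0 < fst ab /\ fst ab <= snd ab /\ snd ab < 1)
    ltac:(simpl; intros; lra)).
  unfold filtermapi. generalize (filter_and _ _ HL HB). apply filter_imp.
  intros [a b] [HPab [Ha [Hab Hb]]]; simpl in *.
  eexists; split; [|exact HPab].
  apply is_RInt_derive; intros t; rewrite Rmin_left, Rmax_right by lra;
    intros Ht; [apply HF|apply Hf]; lra.
Qed.

Lemma is_RInt_gen_01_ext {V : NormedModule R_AbsRing} (f g : R -> V) (l : V) :
  (forall t, 0 < t < 1 -> f t = g t) ->
  is_RInt_gen f (at_right 0) (at_left 1) l ->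
  is_RInt_gen g (at_right 0) (at_left 1) l.
Proof.
  intros H. apply is_RInt_gen_ext; try apply filter_filter.
  apply filter_prod_01. intros a b Ha Hab Hb t. simpl.
  rewrite Rmin_left, Rmax_right by lra. intros Ht. apply H. lra.
Qed.

Lemma sqrt_1_minus_pos (t : R) : 0 < t < 1 -> 0 < sqrt (1 - t).
Proof. intros Ht. apply sqrt_lt_R0. lra. Qed.

Lemma continuous_sqrt_1_minus (t : R) : continuous (fun t => sqrt (1 - t)) t.
Proof.
  apply (continuous_comp (fun t => 1 - t) sqrt); [|apply continuous_sqrt].
  apply (ex_derive_continuous (fun t => 1 - t)). auto_derive. easy.
Qed.

Lemma is_derive_sqrt_1_minus (t : R) : 0 < t < 1 ->
  is_derive (fun t => sqrt (1 - t)) t (- / (2 * sqrt (1 - t))).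
Proof.
  intros Ht. assert (Hq := sqrt_1_minus_pos t Ht).
  auto_derive; [lra|]. change (1 + - t) with (1 - t). field. lra.
Qed.

(* Substituting [t = 1 - u^2] removes the singularity at [1]. *)
Lemma ex_RInt_gen_div_sqrt {V : CompleteNormedModule R_AbsRing} (g : R -> V) :
  (forall t, continuous g t) ->
  ex_RInt_gen (fun t => scal (/ sqrt (1 - t)) (g t)) (at_right 0) (at_left 1).
Proof.
  intros Hg.
  (* Since dt = -2 u du and the weight is 1/u, the factors u cancel and a continuous integrand
     remains. *)
  set (h := fun u : R => scal (-2) (g (1 - u ^ 2))).
  assert (Hh : forall u, continuous h u).
  { intros u. apply (continuous_scal_r (-2) (fun u => g (1 - u ^ 2))).
    apply (continuous_comp (fun u => 1 - u ^ 2) g); [|apply Hg].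
    apply (ex_derive_continuous (fun u => 1 - u ^ 2)). auto_derive. easy. }
  set (H := fun u => RInt h 0 u).
  assert (HH : forall u, is_derive H u (h u)).
  { intros u. apply (is_derive_RInt h H 0 u); [|apply Hh].
    apply filter_forall. intros v. apply RInt_correct, ex_RInt_continuous.
    intros; apply Hh. }
  assert (Hs : forall t, continuous (fun t => H (sqrt (1 - t))) t).
  { intros t. apply (continuous_comp (fun t => sqrt (1 - t)) H).
    - apply continuous_sqrt_1_minus.
    - apply (ex_derive_continuous (V := V) H). eexists; apply HH. }
  eexists. apply (is_RInt_gen_01_derive (fun t => H (sqrt (1 - t)))).
  - intros t Ht.
    assert (Hq := sqrt_1_minus_pos t Ht).
    replace (scal (/ sqrt (1 - t)) (g t))
      with (scal (- / (2 * sqrt (1 - t))) (h (sqrt (1 - t)))).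
    + apply (is_derive_comp H); [apply HH|]. now apply is_derive_sqrt_1_minus.
    + unfold h. rewrite pow2_sqrt by lra. rewrite scal_assoc.
      replace (1 - (1 - t)) with t by ring. f_equal.
      unfold mult; simpl. field. lra.
  - intros t Ht.
    apply (continuous_scal (fun t => / sqrt (1 - t)) g); [|apply Hg].
    apply (ex_derive_continuous (fun t => / sqrt (1 - t))).
    assert (Hq := sqrt_1_minus_pos t Ht).
    auto_derive. change (1 + - t) with (1 - t). split; lra.
  - exact (filterlim_filter_le_1 _ (filter_le_within (F := locally 0) _) (Hs 0)).
  - exact (filterlim_filter_le_1 _ (filter_le_within (F := locally 1) _) (Hs 1)).
Qed.

(** * Complex powers of positive reals *)

Lemma Cexp_plus (z w : C) : Cexp (z + w) = (Cexp z * Cexp w)%C.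
Proof.
  unfold Cexp, Cmult; destruct z as [a b], w as [c d]; simpl.
  rewrite exp_plus, cos_plus, sin_plus. f_equal; ring.
Qed.

Lemma Cexp_0 : Cexp 0 = 1.
Proof. unfold Cexp; simpl. rewrite exp_0, cos_0, sin_0. unfold RtoC. f_equal; ring. Qed.

Lemma Cmod_Cexp (z : C) : Cmod (Cexp z) = exp (Re z).
Proof.
  unfold Cmod, Cexp; simpl.
  replace (_ + _) with (exp (Re z) ^ 2).
  - apply sqrt_pow2. apply Rlt_le, exp_pos.
  - assert (H := sin2_cos2 (Im z)). unfold Rsqr in H.
    transitivity (exp (Re z) ^ 2 * (sin (Im z) * sin (Im z) + cos (Im z) * cos (Im z)));
      [rewrite H|]; ring.
Qed.

Lemma Cmod_Rcpow (t : R) (s : C) : Cmod (Rcpow t s) = exp (Re s * ln t).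
Proof. unfold Rcpow. rewrite Cmod_Cexp. f_equal. destruct s; simpl. ring. Qed.

Lemma Rcpow_plus (t : R) (s r : C) : Rcpow t (s + r) = (Rcpow t s * Rcpow t r)%C.
Proof. unfold Rcpow. rewrite <- Cexp_plus. f_equal. ring. Qed.

Lemma Rcpow_1 (t : R) : 0 < t -> Rcpow t 1 = t.
Proof.
  intros Ht. unfold Rcpow, Cexp; simpl.
  replace (1 * ln t - 0 * 0) with (ln t) by ring.
  replace (1 * 0 + 0 * ln t) with 0 by ring.
  rewrite exp_ln, cos_0, sin_0 by easy. unfold RtoC. f_equal; ring.
Qed.

Lemma Rcpow_INR (t : R) (n : nat) : 0 < t -> Rcpow t (INR n) = RtoC (t ^ n).
Proof.
  intros Ht. induction n as [|n IH].
  - unfold Rcpow. simpl. rewrite Cmult_0_l. apply Cexp_0.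
  - rewrite S_INR, RtoC_plus, Rcpow_plus, IH, Rcpow_1 by easy.
    rewrite <- RtoC_mult. f_equal. simpl. ring.
Qed.

Lemma is_derive_C (u v : R -> R) (t du dv : R) :
  is_derive u t du -> is_derive v t dv ->
  is_derive (V := C_R_NormedModule) (fun t => (u t, v t)) t (du, dv).
Proof.
  intros Hu Hv.
  assert (E : forall a b : R, @plus C_R_NormedModule
      (@scal R_AbsRing C_R_NormedModule a (1, 0))
      (@scal R_AbsRing C_R_NormedModule b (0, 1)) = (a, b)).
  { intros a b. unfold plus, scal; simpl. unfold prod_plus, prod_scal; simpl.
    unfold plus, scal, mult; simpl. unfold mult; simpl. f_equal; ring. }
  rewrite <- E.
  apply (is_derive_ext (V := C_R_NormedModule)
    (fun t => @plus C_R_NormedModule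
      (@scal R_AbsRing C_R_NormedModule (u t) (1, 0))
      (@scal R_AbsRing C_R_NormedModule (v t) (0, 1)))); [intros; apply E|].
  apply (is_derive_plus (V := C_R_NormedModule));
    apply (is_derive_scal_l (V := C_R_NormedModule)); assumption.
Qed.

Lemma is_derive_Rcpow (t : R) (s : C) : 0 < t ->
  is_derive (V := C_R_NormedModule) (fun t => Rcpow t s) t (s * Rcpow t (s - 1))%C.
Proof.
  intros Ht.
  (* This is the shape in which differentiating through [ln t] produces the derivative. *)
  assert (E : (s * Rcpow t (s - 1) = s * Rcpow t s * RtoC (/ t))%C).
  { assert (H : Rcpow t s = (Rcpow t (s - 1) * t)%C).
    { rewrite <- (Rcpow_1 t) by easy. rewrite <- Rcpow_plus. f_equal. ring. }
    rewrite H, RtoC_inv by lra. field. intros H0. apply RtoC_inj in H0. lra. }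
  rewrite E. destruct s as [a b].
  unfold Rcpow, Cexp, Cmult; simpl.
  apply is_derive_C; (auto_derive; [easy|]);
    change (a * ln t + - (b * 0)) with (a * ln t - b * 0); ring.
Qed.

Lemma continuous_Rcpow (t : R) (s : C) : 0 < t ->
  continuous (U := C_R_NormedModule) (fun t => Rcpow t s) t.
Proof.
  intros Ht. apply (ex_derive_continuous (V := C_R_NormedModule)).
  eexists. now apply is_derive_Rcpow.
Qed.

Lemma is_lim_Rcpow_0 (s : C) : 0 < Re s ->
  filterlim (fun t => Rcpow t s) (at_right 0) (locally (T := C_R_NormedModule) (RtoC 0)).
Proof.
  intros Hs.
  apply (filterlim_norm_zero (V := C_R_NormedModule)).
  apply filterlim_ext with (fun t => exp (Re s * ln t)).
  { intros t. rewrite <- Cmod_norm. now rewrite Cmod_Rcpow. }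
  apply (filterlim_comp _ _ _ (fun t => Re s * ln t) exp _ (Rbar_locally m_infty)).
  2: apply is_lim_exp_m.
  apply (filterlim_comp _ _ _ ln (fun y => Re s * y) _ (Rbar_locally m_infty)).
  1: apply is_lim_ln_0.
  replace m_infty with (Rbar_mult (Re s) m_infty) at 2.
  - apply filterlim_Rbar_mult_l.
  - simpl. destruct (Rle_dec 0 (Re s)) as [H|H]; [|lra].
    destruct (Rle_lt_or_eq_dec 0 (Re s) H); [easy|lra].
Qed.

Lemma is_linear_Cmult (c : C) :
  is_linear (U := C_R_NormedModule) (V := C_R_NormedModule) (fun z => (c * z)%C).
Proof.
  split.
  - intros z w. change ((c * (z + w) = c * z + c * w)%C). ring.
  - intros k z. unfold scal; simpl. unfold prod_scal, scal; simpl.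
    unfold mult; simpl. unfold Cmult; simpl. f_equal; ring.
  (* The constant must be positive, while [Cmod c] may be 0. *)
  - exists (Cmod c + 1). split; [assert (H := Cmod_ge_0 c); lra|].
    intros z. rewrite <- !Cmod_norm, Cmod_mult.
    apply Rmult_le_compat_r; [apply Cmod_ge_0|lra].
Qed.

Lemma is_linear_Re :
  is_linear (U := C_R_NormedModule) (V := R_NormedModule) Re.
Proof.
  split; try easy.
  exists 1. split; [lra|]. intros z. rewrite <- Cmod_norm, Rmult_1_l.
  apply re_le_Cmod.
Qed.

(* [1 - t^a] is the integral over [t, 1] of [a r^(a-1)], of modulus at most [|a| / t]. *)
Lemma Cmod_Rcpow_minus_1 (a : C) (t : R) : 0 < Re a -> 0 < t <= 1 ->
  Cmod (Rcpow t a - 1) <= Cmod a * (1 - t) / t.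
Proof.
  intros Ha Ht.
  assert (HI : is_RInt (V := C_R_NormedModule) (fun r => (a * Rcpow r (a - 1))%C)
    t 1 (@minus C_R_NormedModule (Rcpow 1 a) (Rcpow t a))).
  { apply (is_RInt_derive (V := C_R_CompleteNormedModule) (fun r => Rcpow r a)
      (fun r => (a * Rcpow r (a - 1))%C));
    intros r; rewrite Rmin_left, Rmax_right by lra; intros Hr.
    - apply is_derive_Rcpow. lra.
    - apply (continuous_comp (fun r => Rcpow r (a - 1)) (fun z => (a * z)%C)).
      + apply continuous_Rcpow. lra.
      + exact (linear_cont _ _ (is_linear_Cmult a)). }
  apply (norm_RInt_le_const _ t 1 _ (Cmod a / t)) in HI; [|lra|].
  - replace (Cmod (Rcpow t a - 1)) with (Cmod (1 - Rcpow t a))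
      by (rewrite <- Cmod_opp; f_equal; ring).
    replace (RtoC 1) with (Rcpow 1 a)
      by (unfold Rcpow; rewrite ln_1, Cmult_0_r; apply Cexp_0).
    rewrite Cmod_norm. unfold Rdiv in *.
    replace (Cmod a * (1 - t) * / t) with ((1 - t) * (Cmod a * / t)) by ring.
    exact HI.
  - intros r Hr. rewrite <- Cmod_norm, Cmod_mult, Cmod_Rcpow.
    apply Rmult_le_compat_l; [apply Cmod_ge_0|].
    (* The modulus splits as r^(Re a) times 1/r: the first factor is at most 1 because Re a > 0 and
       r <= 1, the second at most 1/t. *)
    replace (Re (a - 1) * ln r) with (Re a * ln r + - ln r)
      by (destruct a; simpl; ring).
    rewrite exp_plus, exp_Ropp, exp_ln by lra.
    assert (Hln : ln r <= 0) by (rewrite <- ln_1; apply ln_le; lra).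
    assert (He : exp (Re a * ln r) <= 1).
    { rewrite <- exp_0. destruct (Req_dec (Re a * ln r) 0) as [->|Hne]; [lra|].
      apply Rlt_le, exp_increasing. nra. }
    assert (Hi : / r <= / t) by (apply Rinv_le_contravar; lra).
    assert (0 < / r) by (apply Rinv_0_lt_compat; lra).
    assert (0 < exp (Re a * ln r)) by apply exp_pos. nra.
Qed.

Lemma scal_C (k : R) (z : C) : @scal R_AbsRing C_R_NormedModule k z = (k * z)%C.
Proof.
  unfold scal; simpl. unfold prod_scal, scal; simpl. unfold mult; simpl.
  unfold Cmult; simpl. f_equal; ring.
Qed.

Lemma continuous_C_of_norm (f : R -> C) (t : R) :
  filterlim (fun u => Cmod (f u - f t)) (locally t) (locally 0) ->
  continuous (U := C_R_NormedModule) f t.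
Proof.
  intros H. apply (filterlim_locally_ball_norm (U := C_R_NormedModule)). intros eps.
  apply (filterlim_locally (U := R_UniformSpace)) with (eps := eps) in H.
  revert H. apply filter_imp. intros u Hu. unfold ball_norm.
  rewrite <- Cmod_norm. change (Rabs (Cmod (f u - f t) - 0) < eps) in Hu.
  rewrite Rminus_0_r, Rabs_pos_eq in Hu by apply Cmod_ge_0. exact Hu.
Qed.

(** * The integrals J(s) *)

(** Dividing by the root, instead of taking a second power, makes the integral in the theorem
    convertible to that of [beta_kernel (x / 2 - 1)]. *)
Definition beta_kernel (s : C) (t : R) : C := (Rcpow t s / RtoC (sqrt (1 - t)))%C.

Lemma RtoC_neq_0 (r : R) : r <> 0 -> RtoC r <> 0.
Proof. intros H E. apply H. now apply RtoC_inj. Qed.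

Lemma beta_kernel_scal (s : C) (t : R) : 0 < t < 1 ->
  beta_kernel s t = @scal R_AbsRing C_R_NormedModule (/ sqrt (1 - t)) (Rcpow t s).
Proof.
  intros Ht. assert (H := sqrt_1_minus_pos t Ht).
  rewrite scal_C. unfold beta_kernel, Cdiv. rewrite RtoC_inv by lra. apply Cmult_comm.
Qed.

Lemma continuous_beta_kernel (s : C) (t : R) : 0 < t < 1 ->
  continuous (U := C_R_NormedModule) (beta_kernel s) t.
Proof.
  intros Ht. assert (H := sqrt_1_minus_pos t Ht).
  apply (continuous_ext_loc (U := C_R_NormedModule) _ (fun t =>
    @scal R_AbsRing C_R_NormedModule (/ sqrt (1 - t)) (Rcpow t s))).
  - assert (Hd : 0 < Rmin t (1 - t)) by (apply Rmin_glb_lt; lra).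
    exists (mkposreal _ Hd). intros u Hu. symmetry. apply beta_kernel_scal.
    change (Rabs (u - t) < Rmin t (1 - t)) in Hu. apply Rabs_def2 in Hu.
    assert (H1 := Rmin_l t (1 - t)). assert (H2 := Rmin_r t (1 - t)). lra.
  - apply (continuous_scal (V := C_R_NormedModule) (fun t => / sqrt (1 - t))
      (fun t => Rcpow t s)).
    + apply (ex_derive_continuous (fun t => / sqrt (1 - t))).
      auto_derive. change (1 + - t) with (1 - t). split; lra.
    + apply continuous_Rcpow. lra.
Qed.

(** For Re s > 0 the power extends continuously by 0 to t <= 0, which leaves only the singularity at
    1. *)
Lemma ex_CInt01_beta_kernel_pos (s : C) : 0 < Re s -> ex_CInt01 (beta_kernel s).
Proof.
  intros Hs.
  (* [Rcpow t s] cannot serve unmodified: [ln] is 0 for t <= 0, so its value there is 1. *)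
  set (g := fun t => if Rlt_dec 0 t then Rcpow t s else RtoC 0).
  assert (Hg : forall t, continuous (U := C_R_NormedModule) g t).
  { intros t. destruct (Rtotal_order t 0) as [Ht|[Ht|Ht]].
    - apply (continuous_ext_loc (U := C_R_NormedModule) _ (fun _ => RtoC 0)).
      2: apply continuous_const.
      exists (mkposreal (- t) ltac:(lra)). intros u Hu.
      change (Rabs (u - t) < - t) in Hu. apply Rabs_def2 in Hu.
      unfold g. destruct (Rlt_dec 0 u); [lra|easy].
    - subst t. apply continuous_C_of_norm.
      assert (H := is_lim_Rcpow_0 s Hs).
      apply (filterlim_locally (U := R_UniformSpace)). intros eps.
      assert (H' := proj1 (filterlim_locally_ball_norm (U := C_R_NormedModule) _ _) H eps).
      destruct H' as [d Hd]. exists d. intros u Hu.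
      unfold g. destruct (Rlt_dec 0 0); [lra|].
      change (Rabs (Cmod ((if Rlt_dec 0 u then Rcpow u s else 0) - 0) - 0) < eps).
      rewrite Rminus_0_r, Rabs_pos_eq by apply Cmod_ge_0.
      destruct (Rlt_dec 0 u) as [Hu0|Hu0].
      + specialize (Hd u Hu Hu0). unfold ball_norm in Hd.
        rewrite <- Cmod_norm in Hd. exact Hd.
      + replace (0 - 0)%C with (RtoC 0) by ring. rewrite Cmod_0. apply cond_pos.
    - apply (continuous_ext_loc (U := C_R_NormedModule) _ (fun t => Rcpow t s)).
      2: now apply continuous_Rcpow.
      exists (mkposreal t Ht). intros u Hu.
      change (Rabs (u - t) < t) in Hu. apply Rabs_def2 in Hu.
      unfold g. destruct (Rlt_dec 0 u); [easy|lra]. }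
  destruct (ex_RInt_gen_div_sqrt (V := C_R_CompleteNormedModule) g Hg) as [l Hl].
  exists l. revert Hl. apply is_RInt_gen_01_ext. intros t Ht.
  rewrite beta_kernel_scal by easy. unfold g. destruct (Rlt_dec 0 t); [easy|lra].
Qed.

(** The relational form lets the recurrence transport existence together with the value. *)
Definition is_J (s l : C) : Prop :=
  is_RInt_gen (V := C_R_NormedModule) (beta_kernel s) (at_right 0) (at_left 1) l.

Lemma is_RInt_gen_01_Cmult (f : R -> C) (c l : C) :
  is_RInt_gen (V := C_R_NormedModule) f (at_right 0) (at_left 1) l ->
  is_RInt_gen (V := C_R_NormedModule) (fun t => c * f t)%C (at_right 0) (at_left 1) (c * l)%C.
Proof.
  exact (is_RInt_gen_linear (U := C_R_NormedModule) (V := C_R_NormedModule)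
    _ (is_linear_Cmult c) f (at_right 0) (at_left 1) l).
Qed.

(** With q = sqrt(1-t), the product rule gives (s+1) t^s q - t^(s+1)/(2q). Writing q as (1-t)/q
    turns this into a combination of two kernels, with 3/2 = 1 + 1/2. *)
Lemma is_derive_Rcpow_sqrt (s : C) (t : R) : 0 < t < 1 ->
  is_derive (V := C_R_NormedModule)
    (fun t => @scal R_AbsRing C_R_NormedModule (sqrt (1 - t)) (Rcpow t (s + 1))) t
    ((s + 1) * beta_kernel s t - (s + 3 / 2) * beta_kernel (s + 1) t)%C.
Proof.
  intros Ht. assert (Hq := sqrt_1_minus_pos t Ht).
  assert (Dq := is_derive_sqrt_1_minus t Ht).
  assert (Dp := is_derive_Rcpow t (s + 1) (proj1 Ht)).
  eapply filterdiff_ext_lin.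
  { apply (filterdiff_scal_fct (V := C_R_NormedModule) t (fun t => sqrt (1 - t))
      (fun t => Rcpow t (s + 1))); [apply Rmult_comm|exact Dq|exact Dp]. }
  intros y. simpl. rewrite !scal_C.
  replace (s + 1 - 1)%C with s by ring.
  unfold beta_kernel. rewrite !Rcpow_plus, Rcpow_1 by easy.
  set (q := sqrt (1 - t)) in *.
  assert (Et : RtoC t = (1 - RtoC q * RtoC q)%C).
  { rewrite <- RtoC_mult, <- RtoC_minus. f_equal. unfold q.
    rewrite sqrt_sqrt; lra. }
  change (@scal R_AbsRing R_NormedModule y (- / (2 * q))) with (y * - / (2 * q)).
  unfold plus; simpl. unfold prod_plus, plus; simpl.
  change (RtoC (y * - / (2 * q)) * (Rcpow t s * RtoC t) +
    RtoC q * (RtoC y * ((s + 1) * Rcpow t s)) =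
    RtoC y * ((s + 1) * (Rcpow t s / RtoC q) - (s + 3 / 2) * (Rcpow t s * RtoC t / RtoC q)))%C.
  assert (Hq0 : RtoC q <> 0) by (apply RtoC_neq_0; lra).
  rewrite RtoC_mult, RtoC_opp, RtoC_inv, RtoC_mult, Et by lra.
  field. easy.
Qed.

(** Both boundary values vanish: t^(s+1) tends to 0 at 0 because Re s > -1, and sqrt(1-t) is 0 at
    1. *)
Lemma is_RInt_gen_Rcpow_sqrt (s : C) : -1 < Re s ->
  is_RInt_gen (V := C_R_NormedModule)
    (fun t => (s + 1) * beta_kernel s t - (s + 3 / 2) * beta_kernel (s + 1) t)%C
    (at_right 0) (at_left 1) (RtoC 0).
Proof.
  intros Hs.
  replace (RtoC 0) with (@minus C_R_NormedModule (RtoC 0) (RtoC 0))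
    by exact (minus_eq_zero (G := C_R_NormedModule) _).
  apply (is_RInt_gen_01_derive (V := C_R_CompleteNormedModule)
    (fun t => @scal R_AbsRing C_R_NormedModule (sqrt (1 - t)) (Rcpow t (s + 1)))).
  - intros t Ht. now apply is_derive_Rcpow_sqrt.
  - intros t Ht.
    assert (Hm : forall c r : C,
      continuous (U := C_R_NormedModule) (fun t => c * beta_kernel r t)%C t).
    { intros c r. apply (continuous_comp (beta_kernel r) (fun z => (c * z)%C)).
      - now apply continuous_beta_kernel.
      - exact (linear_cont _ _ (is_linear_Cmult c)). }
    exact (continuous_minus (V := C_R_NormedModule) _ _ t
      (Hm (s + 1)%C s) (Hm (s + 3 / 2)%C (s + 1)%C)).
  - assert (Hc0 : filterlim (fun t => sqrt (1 - t)) (at_right 0) (locally (sqrt (1 - 0)))).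
    { apply (filterlim_filter_le_1 _ (filter_le_within (F := locally 0) _)).
      apply continuous_sqrt_1_minus. }
    assert (Hp : 0 < Re (s + 1)) by (destruct s; simpl in *; lra).
    replace (RtoC 0) with (@scal R_AbsRing C_R_NormedModule (sqrt (1 - 0)) (RtoC 0))
      by exact (scal_zero_r (V := C_R_NormedModule) _).
    exact (filterlim_comp_2 _ _ (@scal R_AbsRing C_R_NormedModule) Hc0
      (is_lim_Rcpow_0 _ Hp) (filterlim_scal (V := C_R_NormedModule) _ _)).
  - replace (RtoC 0) with (@scal R_AbsRing C_R_NormedModule (sqrt (1 - 1)) (Rcpow 1 (s + 1))).
    + apply (filterlim_filter_le_1 _ (filter_le_within (F := locally 1) _)).
      apply (continuous_scal (V := C_R_NormedModule) (fun t => sqrt (1 - t))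
        (fun t => Rcpow t (s + 1))); [apply continuous_sqrt_1_minus|].
      apply continuous_Rcpow. lra.
    + rewrite Rminus_diag_eq, sqrt_0 by easy.
      exact (scal_zero_l (V := C_R_NormedModule) _).
Qed.

Lemma Re_plus_1_neq_0 (s : C) : -1 < Re s -> (s + 1)%C <> 0.
Proof. intros Hs E. apply (f_equal Re) in E. destruct s; simpl in *. lra. Qed.

(** The kernel at s is a multiple of the exact derivative, whose integral is 0, plus a multiple of
    the kernel at s + 1; hence convergence descends. *)
Lemma is_J_pred (s l : C) : -1 < Re s ->
  is_J (s + 1) l -> is_J s ((s + 3 / 2) / (s + 1) * l)%C.
Proof.
  intros Hs H. assert (H1 := Re_plus_1_neq_0 s Hs).
  assert (H0 := is_RInt_gen_01_Cmult _ (/ (s + 1))%C _ (is_RInt_gen_Rcpow_sqrt s Hs)).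
  apply (is_RInt_gen_01_Cmult _ ((s + 3 / 2) / (s + 1))%C) in H.
  assert (HS := is_RInt_gen_plus (V := C_R_NormedModule) _ _ _ _ H0 H).
  replace ((s + 3 / 2) / (s + 1) * l)%C
    with (@plus C_R_NormedModule (/ (s + 1) * 0)%C ((s + 3 / 2) / (s + 1) * l)%C).
  - revert HS. apply is_RInt_gen_01_ext. intros t Ht.
    change (/ (s + 1) * ((s + 1) * beta_kernel s t - (s + 3 / 2) * beta_kernel (s + 1) t)
      + (s + 3 / 2) / (s + 1) * beta_kernel (s + 1) t = beta_kernel s t)%C.
    field. easy.
  - change (/ (s + 1) * 0 + (s + 3 / 2) / (s + 1) * l = (s + 3 / 2) / (s + 1) * l)%C.
    ring.
Qed.

Lemma ex_CInt01_beta_kernel (s : C) : -1 < Re s -> ex_CInt01 (beta_kernel s).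
Proof.
  intros Hs. destruct (ex_CInt01_beta_kernel_pos (s + 1)%C) as [l Hl].
  - destruct s; simpl in *; lra.
  - eexists. exact (is_J_pred s l Hs Hl).
Qed.

(* [J s] is [B (s + 1, 1 / 2)]. *)
Definition J (s : C) : C := CInt01 (beta_kernel s).

Lemma is_J_unique (s l : C) : is_J s l -> J s = l.
Proof.
  exact (is_RInt_gen_unique (V := C_R_CompleteNormedModule) (Fa := at_right 0)
    (Fb := at_left 1) (beta_kernel s) l).
Qed.

Lemma J_correct (s : C) : -1 < Re s -> is_J s (J s).
Proof.
  intros Hs. exact (RInt_gen_correct (V := C_R_CompleteNormedModule) (Fa := at_right 0)
    (Fb := at_left 1) (beta_kernel s) (ex_CInt01_beta_kernel s Hs)).
Qed.

Lemma J_rec (s : C) : -1 < Re s -> ((s + 1) * J s = (s + 3 / 2) * J (s + 1))%C.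
Proof.
  intros Hs. assert (H1 := Re_plus_1_neq_0 s Hs).
  assert (Hs1 : -1 < Re (s + 1)) by (destruct s; simpl in *; lra).
  rewrite (is_J_unique _ _ (is_J_pred s _ Hs (J_correct _ Hs1))).
  field. easy.
Qed.

Lemma J_0 : J 0 = 2.
Proof.
  apply is_J_unique. unfold is_J.
  (* These are the values at 1 and 0 of the antiderivative -2 sqrt(1-t). *)
  replace (RtoC 2) with (@minus C_R_NormedModule (RtoC 0) (RtoC (-2)))
    by (unfold minus, plus, opp, RtoC; simpl; unfold prod_plus, prod_opp, plus, opp; simpl;
        f_equal; ring).
  assert (Hc : forall t, continuous (U := C_R_NormedModule)
    (fun t => @scal R_AbsRing C_R_NormedModule (-2 * sqrt (1 - t)) (RtoC 1)) t).
  { intros t. apply (continuous_scal_l (V := C_R_NormedModule) (fun t => -2 * sqrt (1 - t))).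
    apply (continuous_scal_r (V := R_NormedModule) (-2) (fun t => sqrt (1 - t))).
    apply continuous_sqrt_1_minus. }
  apply (is_RInt_gen_01_derive (V := C_R_CompleteNormedModule)
    (fun t => @scal R_AbsRing C_R_NormedModule (-2 * sqrt (1 - t)) (RtoC 1))).
  - intros t Ht. rewrite beta_kernel_scal by easy.
    assert (Hq := sqrt_1_minus_pos t Ht).
    unfold Rcpow. rewrite Cmult_0_l, Cexp_0.
    apply (is_derive_scal_l (V := C_R_NormedModule) (fun t => -2 * sqrt (1 - t))).
    auto_derive; [lra|]. change (1 + - t) with (1 - t). field. lra.
  - intros t Ht. now apply continuous_beta_kernel.
  - replace (RtoC (-2)) with (@scal R_AbsRing C_R_NormedModule (-2 * sqrt (1 - 0)) (RtoC 1)).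
    + exact (filterlim_filter_le_1 _ (filter_le_within (F := locally 0) _) (Hc 0)).
    + rewrite scal_C, Rminus_0_r, sqrt_1, Rmult_1_r. apply Cmult_1_r.
  - replace (RtoC 0) with (@scal R_AbsRing C_R_NormedModule (-2 * sqrt (1 - 1)) (RtoC 1)).
    + exact (filterlim_filter_le_1 _ (filter_le_within (F := locally 1) _) (Hc 1)).
    + rewrite (Rminus_diag_eq 1 1 eq_refl), sqrt_0, Rmult_0_r.
      exact (scal_zero_l (V := C_R_NormedModule) _).
Qed.

(** Reality and positivity spread from [J 0 = 2] through the recurrence, whose ratio is real and
    positive. They make [J (INR n)] a legitimate divisor with modulus equal to its real part. *)
Lemma Re_J_INR (n : nat) :
  J (INR n) = RtoC (Re (J (INR n))) /\ 0 < Re (J (INR n)) /\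
  (INR n + 1) * Re (J (INR n)) = (INR n + 3 / 2) * Re (J (INR (S n))).
Proof.
  assert (Hrec : forall n, J (INR n) = RtoC (Re (J (INR n))) ->
    J (INR (S n)) = RtoC ((INR n + 1) / (INR n + 3 / 2) * Re (J (INR n)))).
  { intros m Hm. assert (Hm0 := pos_INR m).
    assert (HJ := J_rec (INR m) ltac:(simpl; lra)).
    rewrite S_INR, RtoC_plus, RtoC_mult, RtoC_div, <- Hm by lra.
    rewrite !RtoC_plus, RtoC_div by lra.
    assert (Hd : (INR m + 3 / 2)%C <> 0).
    { rewrite <- RtoC_div, <- RtoC_plus by lra. apply RtoC_neq_0. lra. }
    transitivity (/ (INR m + 3 / 2) * ((INR m + 3 / 2) * J (INR m + 1)))%C.
    - field. intros E. apply Hd.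
      transitivity ((INR m * 2 + 3) / 2)%C; [field|rewrite E; field].
    - rewrite <- HJ. field. intros E. apply Hd.
      transitivity ((INR m * 2 + 3) / 2)%C; [field|rewrite E; field]. }
  assert (Hn : forall n, J (INR n) = RtoC (Re (J (INR n))) /\ 0 < Re (J (INR n))).
  { intros m. induction m as [|m [E P]].
    - simpl INR. rewrite J_0. split; [easy|exact Rlt_0_2].
    - rewrite (Hrec m E). rewrite re_RtoC. split; [easy|].
      assert (Hm0 := pos_INR m).
      apply Rmult_lt_0_compat; [apply Rdiv_lt_0_compat|]; lra. }
  destruct (Hn n) as [E P]. split; [exact E|split; [exact P|]].
  rewrite (Hrec n E). rewrite re_RtoC. assert (Hm0 := pos_INR n). field. lra.
Qed.

(** The kernels differ by the factor t^a - 1, and the 1/t in its bound uses up one power of t: this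
    is why [n] appears on the right against [S n] on the left. *)
Lemma J_shift_bound (a : C) (n : nat) : 0 < Re a ->
  Cmod (J (a + INR (S n)) - J (INR (S n))) <=
  Cmod a * (Re (J (INR n)) - Re (J (INR (S n)))).
Proof.
  intros Ha. assert (Hn := pos_INR n).
  assert (H1 : -1 < Re (a + INR (S n))) by (rewrite S_INR; destruct a; simpl in *; lra).
  assert (H2 : -1 < Re (INR (S n))) by (rewrite S_INR; simpl; lra).
  assert (H3 : -1 < Re (INR n)) by (simpl; lra).
  assert (HC := is_RInt_gen_minus (V := C_R_NormedModule) _ _ _ _
    (J_correct _ H1) (J_correct _ H2)).
  assert (HR : forall m, -1 < Re (INR m) -> is_RInt_gen (V := R_NormedModule)
    (fun t => Re (beta_kernel (INR m) t)) (at_right 0) (at_left 1) (Re (J (INR m)))).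
  { intros m Hm. exact (is_RInt_gen_linear (U := C_R_NormedModule) (V := R_NormedModule)
      _ is_linear_Re _ (at_right 0) (at_left 1) _ (J_correct _ Hm)). }
  assert (HG := is_RInt_gen_scal (V := R_NormedModule) _ (Cmod a) _
    (is_RInt_gen_minus (V := R_NormedModule) _ _ _ _ (HR n H3) (HR (S n) H2))).
  refine (Rle_trans _ _ _ (Req_le _ _ (Cmod_norm _))
    (RInt_gen_norm (V := C_R_CompleteNormedModule) _ _ _ _ _ _ HC HG)).
  - apply filter_prod_01. easy.
  - apply filter_prod_01. simpl fst; simpl snd. intros u v Hu Huv Hv t Ht.
    assert (Ht1 : 0 < t < 1) by lra.
    assert (Hq := sqrt_1_minus_pos t Ht1).
    rewrite <- Cmod_norm.
    assert (EB : forall m, beta_kernel (INR m) t = RtoC (t ^ m / sqrt (1 - t))).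
    { intros m. unfold beta_kernel. rewrite Rcpow_INR, RtoC_div by lra. easy. }
    change (Cmod (beta_kernel (a + INR (S n)) t - beta_kernel (INR (S n)) t) <=
      Cmod a * (Re (beta_kernel (INR n) t) - Re (beta_kernel (INR (S n)) t))).
    replace (beta_kernel (a + INR (S n)) t - beta_kernel (INR (S n)) t)%C
      with ((Rcpow t a - 1) * beta_kernel (INR (S n)) t)%C
      by (unfold beta_kernel; rewrite Rcpow_plus; unfold Cdiv; ring).
    rewrite Cmod_mult, !EB, Cmod_R. rewrite !re_RtoC.
    assert (Hp : 0 < t ^ n) by (apply pow_lt; lra).
    assert (Hb : 0 < t ^ S n / sqrt (1 - t))
      by (apply Rdiv_lt_0_compat; [apply pow_lt|]; lra).
    rewrite Rabs_pos_eq by lra.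
    apply Rle_trans with (Cmod a * (1 - t) / t * (t ^ S n / sqrt (1 - t))).
    + apply Rmult_le_compat_r; [lra|]. apply Cmod_Rcpow_minus_1; lra.
    + apply Req_le. simpl. field. lra.
Qed.

(** * Limits of complex sequences *)

(** Phrased through the modulus so that squeezing and limit arithmetic for real sequences apply. *)
Definition is_Clim_seq (u : nat -> C) (l : C) : Prop :=
  is_lim_seq (fun n => Cmod (u n - l)) 0.

Lemma is_Clim_seq_filterlim (u : nat -> C) (l : C) :
  is_Clim_seq u l <-> filterlim u eventually (locally (T := C_R_NormedModule) l).
Proof.
  unfold is_Clim_seq, is_lim_seq.
  rewrite (filterlim_locally_ball_norm (U := C_R_NormedModule)).
  change (Rbar_locally 0) with (locally (T := R_UniformSpace) 0).
  rewrite (filterlim_locally (U := R_UniformSpace)).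
  assert (E : forall n eps, ball (M := R_UniformSpace) 0 eps (Cmod (u n - l)) <->
    ball_norm (V := C_R_NormedModule) l eps (u n)).
  { intros n eps. change (Rabs (Cmod (u n - l) - 0) < eps <->
      norm (V := C_R_NormedModule) (u n - l)%C < eps).
    rewrite <- Cmod_norm, Rminus_0_r, Rabs_pos_eq by apply Cmod_ge_0. easy. }
  split; intros H eps; generalize (H eps); apply filter_imp; intros n; apply E.
Qed.

Lemma is_Clim_seq_ext (u v : nat -> C) (l : C) :
  (forall n, u n = v n) -> is_Clim_seq u l -> is_Clim_seq v l.
Proof. intros H. apply is_lim_seq_ext. intros n. now rewrite H. Qed.

Lemma is_Clim_seq_bound (u : nat -> C) (l : C) (e : nat -> R) :
  (forall n, Cmod (u n - l) <= e n) -> is_lim_seq e 0 -> is_Clim_seq u l.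
Proof.
  intros H He. apply (is_lim_seq_le_le (fun _ => 0) _ e); [|apply is_lim_seq_const|easy].
  intros n. split; [apply Cmod_ge_0|apply H].
Qed.

Lemma is_Clim_seq_mult (u v : nat -> C) (l m : C) :
  is_Clim_seq u l -> is_Clim_seq v m -> is_Clim_seq (fun n => u n * v n)%C (l * m)%C.
Proof.
  intros Hu Hv.
  apply is_Clim_seq_bound with (fun n =>
    Cmod (u n - l) * Cmod (v n - m) + Cmod l * Cmod (v n - m) + Cmod m * Cmod (u n - l)).
  - intros n. rewrite <- !Cmod_mult.
    replace (u n * v n - l * m)%C with
      ((u n - l) * (v n - m) + l * (v n - m) + m * (u n - l))%C by ring.
    eapply Rle_trans; [apply Cmod_triangle|]. apply Rplus_le_compat_r, Cmod_triangle.
  - replace 0 with (0 * 0 + Cmod l * 0 + Cmod m * 0) by ring.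
    apply is_lim_seq_plus'; [apply is_lim_seq_plus'|];
      apply is_lim_seq_mult'; auto using is_lim_seq_const.
Qed.

(* Avoids inverting in C: [u = (u w) / w]. *)
Lemma is_Clim_seq_of_mult (u w : nat -> C) (l : C) :
  (forall n, u n * w n = l)%C -> is_Clim_seq w 1 -> is_Clim_seq u l.
Proof.
  intros E Hw.
  (* Once |w - 1| < 1/2, also |w| > 1/2 and so |u| <= 2 |l|; moreover u - l = -u (w - 1). *)
  apply (is_lim_seq_le_le_loc (fun _ => 0) _ (fun n => 2 * Cmod l * Cmod (w n - 1))).
  - assert (H := Hw). apply is_lim_seq_spec in H.
    specialize (H (mkposreal (1/2) ltac:(lra))). revert H.
    apply filter_imp. simpl. intros n Hn. split; [apply Cmod_ge_0|].
    rewrite Rminus_0_r, Rabs_pos_eq in Hn by apply Cmod_ge_0.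
    assert (Hd : (u n - l = u n * - (w n - 1))%C) by (rewrite <- (E n); ring).
    rewrite Hd, Cmod_mult, Cmod_opp.
    apply Rmult_le_compat_r; [apply Cmod_ge_0|].
    rewrite <- (E n), Cmod_mult.
    assert (H1 : 1 <= Cmod (w n) + Cmod (w n - 1)).
    { rewrite <- (Cmod_opp (w n - 1)).
      apply Rle_trans with (Cmod 1); [rewrite Cmod_1; lra|].
      eapply Rle_trans; [|apply Cmod_triangle]. apply Req_le. f_equal. ring. }
    assert (H2 := Cmod_ge_0 (u n)). nra.
  - apply is_lim_seq_const.
  - replace (Finite 0) with (Finite (2 * Cmod l * 0)) by (f_equal; ring).
    apply is_lim_seq_mult'; [apply is_lim_seq_const|exact Hw].
Qed.

Lemma is_lim_seq_div_S (c : R) : is_lim_seq (fun n => c / INR (S n)) 0.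
Proof.
  replace (Finite 0) with (Finite (c * 0)) by (f_equal; ring).
  apply is_lim_seq_mult'; [apply is_lim_seq_const|].
  apply (is_lim_seq_incr_1 (fun n => / INR n)).
  replace (Finite 0) with (Rbar_inv p_infty) by easy.
  apply is_lim_seq_inv; [apply is_lim_seq_INR|easy].
Qed.

Lemma is_Clim_seq_J_ratio (a : C) : 0 < Re a ->
  is_Clim_seq (fun n => J (a + INR (S n)) / J (INR (S n)))%C 1.
Proof.
  intros Ha. apply is_Clim_seq_bound with (fun n => Cmod a / INR (S n)).
  2: apply is_lim_seq_div_S.
  intros n. destruct (Re_J_INR (S n)) as [E [P _]].
  destruct (Re_J_INR n) as [_ [_ Hrec]].
  assert (B := J_shift_bound a n Ha).
  assert (HJ : J (INR (S n)) <> 0) by (rewrite E; apply RtoC_neq_0; lra).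
  replace (J (a + INR (S n)) / J (INR (S n)) - 1)%C
    with ((J (a + INR (S n)) - J (INR (S n))) / J (INR (S n)))%C by (field; easy).
  assert (EM : Cmod (J (INR (S n))) = Re (J (INR (S n))))
    by (rewrite E at 1; rewrite Cmod_R, Rabs_pos_eq; lra).
  rewrite Cmod_div, EM by easy.
  set (p := Re (J (INR (S n)))) in *. set (r := Re (J (INR n))) in *.
  assert (Hn := pos_INR n). rewrite S_INR in *.
  apply Rle_trans with (Cmod a * (r - p) / p).
  - apply Rmult_le_compat_r; [apply Rlt_le, Rinv_0_lt_compat, P|exact B].
  (* The recurrence gives r/p = (n + 3/2)/(n + 1), hence (r - p)/p = 1/(2(n + 1)). *)
  - replace r with ((INR n + 3 / 2) / (INR n + 1) * p)
      by (apply Rmult_eq_reg_l with (INR n + 1); [rewrite Hrec; field|]; lra).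
    replace (Cmod a * ((INR n + 3 / 2) / (INR n + 1) * p - p) / p)
      with (Cmod a * (/ 2 * / (INR n + 1))) by (field; lra).
    assert (0 < / (INR n + 1)) by (apply Rinv_0_lt_compat; lra).
    apply Rmult_le_compat_l; [apply Cmod_ge_0|lra].
Qed.

Lemma is_Clim_seq_even_odd (u : nat -> C) (l : C) :
  is_Clim_seq (fun n => u (2 * n)%nat) l -> is_Clim_seq (fun n => u (S (2 * n))) l ->
  is_Clim_seq u l.
Proof.
  unfold is_Clim_seq. rewrite !is_lim_seq_Reals. intros H0 H1 eps Heps.
  destruct (H0 eps Heps) as [n0 E0]. destruct (H1 eps Heps) as [n1 E1].
  exists (2 * n0 + 2 * n1 + 1)%nat. intros n Hn.
  destruct (Nat.Even_or_Odd n) as [[k ->]|[k ->]].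
  - apply E0. lia.
  - replace (2 * k + 1)%nat with (S (2 * k)) by lia. apply E1. lia.
Qed.

(** * The alternating harmonic series *)

(** The argument counts pairs of terms, in step with [Cprod] at [2 * n]. *)
Fixpoint alt_harmonic (n : nat) : R :=
  match n with
  | O => 0
  | S m => alt_harmonic m + / INR (S (2 * m)) - / INR (S (S (2 * m)))
  end.

Fixpoint harmonic (n : nat) : R :=
  match n with
  | O => 0
  | S m => harmonic m + / INR (S m)
  end.

(** Changing the sign of the even terms subtracts twice their sum, and that sum is half of
    [harmonic n]. *)
Lemma alt_harmonic_eq (n : nat) : alt_harmonic n = harmonic (2 * n) - harmonic n.
Proof.
  induction n as [|n IH]; [simpl; ring|].
  replace (2 * S n)%nat with (S (S (2 * n))) by lia.
  cbn [alt_harmonic harmonic]. rewrite IH, !S_INR, !mult_INR. simpl (INR 2).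
  assert (H := pos_INR n). field. lra.
Qed.

Lemma ln_le_minus_1 (y : R) : 0 < y -> ln y <= y - 1.
Proof.
  intros Hy. rewrite <- (ln_exp (y - 1)). apply ln_le; [easy|].
  assert (H := exp_ineq1_le (y - 1)). lra.
Qed.

Lemma ln_succ_bounds (y : R) : 0 < y -> / (y + 1) <= ln (y + 1) - ln y <= / y.
Proof.
  intros Hy. rewrite <- ln_div by lra. split.
  - assert (H := ln_le_minus_1 (y / (y + 1)) ltac:(apply Rdiv_lt_0_compat; lra)).
    rewrite ln_div in * by lra.
    replace (y / (y + 1) - 1) with (- / (y + 1)) in H by (field; lra). lra.
  - assert (H := ln_le_minus_1 ((y + 1) / y) ltac:(apply Rdiv_lt_0_compat; lra)).
    replace ((y + 1) / y - 1) with (/ y) in H by (field; lra). lra.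
Qed.

(** Each 1/(j+1) lies between two increments of [ln], and these telescope. Starting at [S m] keeps
    every logarithm at a positive argument. *)
Lemma harmonic_bounds (m k : nat) :
  ln (INR (S (m + k)) + 1) - ln (INR (S m) + 1) <= harmonic (S (m + k)) - harmonic (S m)
    <= ln (INR (S (m + k))) - ln (INR (S m)).
Proof.
  induction k as [|k IH].
  - rewrite Nat.add_0_r. lra.
  - rewrite Nat.add_succ_r.
    change (harmonic (S (S (m + k)))) with (harmonic (S (m + k)) + / INR (S (S (m + k)))).
    rewrite (S_INR (S (m + k))).
    assert (H : 0 < INR (S (m + k))) by (apply lt_0_INR; lia).
    assert (H1 := ln_succ_bounds _ H).
    assert (H2 := ln_succ_bounds (INR (S (m + k)) + 1) ltac:(lra)). lra.
Qed.

Lemma is_lim_seq_alt_harmonic : is_lim_seq alt_harmonic (ln 2).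
Proof.
  apply is_lim_seq_incr_1.
  (* With N = n + 1, the upper bound is ln(2N) - ln N. The lower one is ln(2N+1) - ln(N+1), which
     falls short of ln 2 by ln(2N+2) - ln(2N+1) <= 1/(2N+1). *)
  apply (is_lim_seq_le_le (fun n => ln 2 - 1 / INR (S n)) _ (fun _ => ln 2)).
  - intros n. assert (Hn := pos_INR n).
    rewrite alt_harmonic_eq.
    assert (H := harmonic_bounds n (S n)).
    replace (2 * S n)%nat with (S (n + S n)) by lia.
    assert (E : INR (S (n + S n)) = 2 * INR (S n)) by (rewrite S_INR, plus_INR, S_INR; ring).
    rewrite E in H. rewrite S_INR in *. rewrite ln_mult in H by lra.
    assert (H1 := ln_succ_bounds (2 * (INR n + 1)) ltac:(lra)).
    assert (H2 := ln_succ_bounds (2 * (INR n + 1) + 1) ltac:(lra)).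
    replace (2 * (INR n + 1) + 1 + 1) with (2 * (INR n + 1 + 1)) in H2 by ring.
    rewrite ln_mult in H2 by lra.
    assert (/ (2 * (INR n + 1) + 1) <= 1 / (INR n + 1))
      by (unfold Rdiv; rewrite Rmult_1_l; apply Rinv_le_contravar; lra).
    lra.
  - replace (Finite (ln 2)) with (Finite (ln 2 - 0)) by (f_equal; ring).
    apply is_lim_seq_minus'; [apply is_lim_seq_const|apply is_lim_seq_div_S].
  - apply is_lim_seq_const.
Qed.

(** * The infinite product *)

Fixpoint pair_prod (x : C) (n : nat) : C :=
  match n with
  | O => 1
  | S m => (pair_prod x m *
      ((1 + x / INR (S (2 * m))) / (1 + x / INR (S (S (2 * m))))))%C
  end.

Lemma Re_div_RtoC (x : C) (r : R) : r <> 0 -> Re (x / r) = Re x / r.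
Proof.
  intros Hr. unfold Cdiv. rewrite <- RtoC_inv, Cmult_comm by easy.
  rewrite re_scal_l. unfold Rdiv. ring.
Qed.

Lemma Re_half_pos (x : C) : 0 < Re x -> 0 < Re (x / 2).
Proof. intros Hx. rewrite Re_div_RtoC; lra. Qed.

Lemma Cinv_mult (z w : C) : z <> 0 -> w <> 0 -> (/ (z * w) = / z * / w)%C.
Proof. intros Hz Hw. field. easy. Qed.

(** With a = x/2, [J_rec] shows that a step from n to n + 1 multiplies (n + 1/2) J(n) by (n + 1)/(n
    + 1/2) and (a + n + 1/2) J(a + n) by (a + n + 1)/(a + n + 1/2). The quotient of these two
    multipliers is the new pair of factors. *)
Lemma pair_prod_J (x : C) (n : nat) : 0 < Re x ->
  (pair_prod x n * ((x / 2 + INR n + 1 / 2) * J (x / 2 + INR n)) =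
   x / 2 * J (x / 2 - 1) * ((INR n + 1 / 2) * J (INR n)))%C.
Proof.
  intros Hx. set (a := (x / 2)%C).
  assert (Ha : 0 < Re a) by now apply Re_half_pos.
  assert (Ex : x = (2 * a)%C) by (unfold a; field).
  assert (Hre : forall r, 0 <= r -> (a + r)%C <> 0).
  { intros r Hr E. apply (f_equal Re) in E. rewrite re_RtoC in E.
    destruct a as [a1 a2]. unfold Re in *. simpl in *. lra. }
  clearbody a. subst x. clear Hx.
  induction n as [|n IH].
  - simpl INR. rewrite J_0. cbn [pair_prod].
    assert (Hm : -1 < Re (a - 1)) by (destruct a as [a1 a2]; unfold Re in *; simpl in *; lra).
    assert (H := J_rec _ Hm).
    replace (a - 1 + 1)%C with a in H by ring.
    replace (a + 0)%C with a by ring.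
    transitivity ((a - 1 + 3 / 2) * J a)%C; [field|]. rewrite <- H. field.
  - assert (Hn := pos_INR n).
    assert (Hm : -1 < Re (a + INR n)) by (destruct a as [a1 a2]; unfold Re in *; simpl in *; lra).
    assert (H := J_rec _ Hm).
    assert (Hm' : -1 < Re (INR n)) by (rewrite re_RtoC; lra).
    assert (H' := J_rec _ Hm').
    cbn [pair_prod].
    replace (a + INR (S n))%C with (a + INR n + 1)%C by (rewrite S_INR, RtoC_plus; ring).
    assert (ES : RtoC (INR (S n)) = (INR n + 1)%C) by (rewrite S_INR, RtoC_plus; ring).
    assert (E1 : RtoC (INR (S (2 * n))) = (2 * INR n + 1)%C)
      by (rewrite S_INR, mult_INR, RtoC_plus, RtoC_mult;
          replace (INR 2) with 2 by (simpl; ring); ring).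
    assert (E2 : RtoC (INR (S (S (2 * n)))) = (2 * INR n + 2)%C)
      by (rewrite !S_INR, mult_INR, !RtoC_plus, RtoC_mult;
          replace (INR 2) with 2 by (simpl; ring); ring).
    rewrite ES, E1, E2.
    assert (N1 : (2 * INR n + 1)%C <> 0).
    { rewrite <- E1. apply RtoC_neq_0. apply not_0_INR. lia. }
    assert (N2 : (2 * INR n + 2)%C <> 0).
    { rewrite <- E2. apply RtoC_neq_0. apply not_0_INR. lia. }
    assert (N3 : (a + INR n + 1)%C <> 0).
    { replace (a + INR n + 1)%C with (a + RtoC (INR n + 1))%C by (rewrite RtoC_plus; ring).
      apply Hre. lra. }
    assert (N4 : (2 * a + (2 * INR n + 2))%C <> 0).
    { intros E. apply N3. transitivity ((2 * a + (2 * INR n + 2)) / 2)%C; [field|].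
      rewrite E. field. }
    set (P := pair_prod (2 * a) n) in *. set (v := RtoC (INR n)) in *.
    set (J1 := J (a + v + 1)) in *. set (J2 := J (v + 1)) in *.
    transitivity (P * ((a + v + 3 / 2) * J1) * ((2 * a + 2 * v + 1) / (2 * v + 1))
      * (2 * (v + 1) / (2 * a + (2 * v + 2))))%C; [field; easy|].
    rewrite <- H.
    transitivity (P * ((a + v + 1 / 2) * J (a + v)) * (2 * (v + 1)) / (2 * v + 1))%C.
    { field. repeat split; easy. }
    rewrite IH.
    transitivity (a * J (a - 1) * ((v + 1) * J v))%C; [field; easy|].
    rewrite H'. field.
Qed.

Lemma is_Clim_seq_pair_prod (x : C) : 0 < Re x ->
  is_Clim_seq (pair_prod x) (x / 2 * J (x / 2 - 1))%C.
Proof.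
  intros Hx.
  assert (Ha := Re_half_pos x Hx).
  (* By [pair_prod_J], multiplying [pair_prod x n] by [q n] and by the ratio of the [J] values gives
     a constant, the claimed limit. Both multipliers tend to 1, since q n - 1 = (x/2)/(n + 1/2). *)
  set (q := fun n => ((x / 2 + INR n + 1 / 2) / (INR n + 1 / 2))%C).
  assert (Hh : forall n, (INR n + 1 / 2)%C <> 0).
  { intros n. assert (Hn := pos_INR n).
    rewrite <- RtoC_div, <- RtoC_plus by lra. apply RtoC_neq_0. lra. }
  apply is_Clim_seq_of_mult with
    (fun n => q n * (J (x / 2 + INR n) / J (INR n)))%C.
  - intros n. destruct (Re_J_INR n) as [E [P _]].
    assert (HJ : J (INR n) <> 0) by (rewrite E; apply RtoC_neq_0; lra).
    transitivity (pair_prod x n * ((x / 2 + INR n + 1 / 2) * J (x / 2 + INR n))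
      / ((INR n + 1 / 2) * J (INR n)))%C.
    { unfold q, Cdiv. rewrite Cinv_mult by (apply Hh || exact HJ). ring. }
    rewrite pair_prod_J by easy. unfold Cdiv. rewrite <- !Cmult_assoc.
    rewrite (Cmult_assoc (INR n + 1 * / 2)%C).
    rewrite Cinv_r by (apply Cmult_neq_0; [apply Hh|easy]). ring.
  - unfold is_Clim_seq. apply is_lim_seq_incr_1.
    replace (RtoC 1) with (1 * 1)%C by ring.
    apply (is_Clim_seq_mult (fun n => q (S n))); [|now apply is_Clim_seq_J_ratio].
    apply is_Clim_seq_bound with (fun n => Cmod (x / 2) / INR (S n)).
    2: apply is_lim_seq_div_S.
    intros n. unfold q.
    replace ((x / 2 + INR (S n) + 1 / 2) / (INR (S n) + 1 / 2) - 1)%C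
      with (x / 2 / (INR (S n) + 1 / 2))%C.
    2: { transitivity ((x / 2 + (INR (S n) + 1 / 2)) / (INR (S n) + 1 / 2) - 1)%C;
         [|f_equal; f_equal; ring].
         generalize (Hh (S n)). generalize (INR (S n) + 1 / 2)%C. intros c Hc.
         unfold Cdiv. rewrite Cmult_plus_distr_r, Cinv_r by easy. ring. }
    rewrite Cmod_div by apply Hh.
    assert (Hn := pos_INR (S n)). assert (0 < INR (S n)) by (apply lt_0_INR; lia).
    rewrite <- RtoC_div, <- RtoC_plus, Cmod_R, Rabs_pos_eq by lra.
    apply Rmult_le_compat_l; [apply Cmod_ge_0|]. apply Rinv_le_contravar; lra.
Qed.

(** * Exponential factors and the limit of the full product *)

Lemma Rcpow_exp (r : R) (s : C) : Rcpow (exp r) s = Cexp (s * r).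
Proof. unfold Rcpow. now rewrite ln_exp. Qed.

Lemma Cexp_opp_r (z : C) : (Cexp z * Cexp (- z))%C = 1.
Proof. rewrite <- Cexp_plus. replace (z + - z)%C with (RtoC 0) by ring. apply Cexp_0. Qed.

Lemma Cexp_neq_0 (z : C) : Cexp z <> 0.
Proof.
  intros E. assert (H := Cexp_opp_r z). rewrite E, Cmult_0_l in H.
  apply RtoC_inj in H. lra.
Qed.

Lemma Cinv_Cexp (z : C) : (/ Cexp z)%C = Cexp (- z).
Proof.
  transitivity (/ Cexp z * (Cexp z * Cexp (- z)))%C; [rewrite Cexp_opp_r; ring|].
  field. apply Cexp_neq_0.
Qed.

(** Along real multiples of [c], [Cexp] is a power of the positive real [exp (u n)], so continuity
    of [Rcpow] in its base suffices. *)
Lemma is_Clim_seq_Cexp (c : C) (u : nat -> R) (l : R) :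
  is_lim_seq u l -> is_Clim_seq (fun n => Cexp (c * u n)) (Cexp (c * l)).
Proof.
  intros H. apply is_Clim_seq_filterlim.
  apply filterlim_ext with (fun n => Rcpow (exp (u n)) c); [intros; apply Rcpow_exp|].
  rewrite <- Rcpow_exp.
  apply (filterlim_comp _ _ _ (fun n => exp (u n)) (fun t => Rcpow t c) _ (locally (exp l))).
  - exact (is_lim_seq_continuous exp u l
      (derivable_continuous_pt _ _ (derivable_pt_exp l)) H).
  - apply continuous_Rcpow, exp_pos.
Qed.

Lemma Cprod_even (x : C) (n : nat) : 0 < Re x ->
  Cprod (tGamma_factor x) (2 * n) = (Cexp (- x * alt_harmonic n) * pair_prod x n)%C.
Proof.
  intros Hx. induction n as [|n IH].
  - simpl. rewrite Cmult_0_r, Cexp_0. ring.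
  - replace (2 * S n)%nat with (S (S (2 * n))) by lia.
    cbn [Cprod alt_harmonic pair_prod]. rewrite IH.
    unfold tGamma_factor.
    rewrite Nat.odd_succ, Nat.odd_succ, Nat.even_succ, Nat.odd_mul.
    replace (Nat.even (2 * n)) with true by (rewrite Nat.even_mul; easy).
    simpl (Nat.odd 2 && Nat.odd n)%bool. cbv iota. unfold tGamma_base.
    assert (P1 : INR (S (2 * n)) <> 0) by (apply not_0_INR; lia).
    assert (P2 : INR (S (S (2 * n))) <> 0) by (apply not_0_INR; lia).
    (* The inverse of the even factor splits only away from its pole x = -k, which 0 < Re x
       excludes. *)
    assert (P3 : (1 + x / INR (S (S (2 * n))))%C <> 0).
    { intros E. apply (f_equal Re) in E.
      change (1 + Re (x / INR (S (S (2 * n)))) = 0) in E.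
      rewrite Re_div_RtoC in E by easy.
      assert (0 < Re x / INR (S (S (2 * n))))
        by (apply Rdiv_lt_0_compat; [easy|apply lt_0_INR; lia]).
      lra. }
    rewrite Cinv_mult, Cinv_Cexp by (apply Cexp_neq_0 || exact P3).
    rewrite RtoC_minus, RtoC_plus, !RtoC_inv by easy.
    replace (- x * (alt_harmonic n + / INR (S (2 * n)) - / INR (S (S (2 * n)))))%C
      with (- x * alt_harmonic n + - (x / INR (S (2 * n)))
        + - - (x / INR (S (S (2 * n)))))%C by (unfold Cdiv; ring).
    rewrite !Cexp_plus. unfold Cdiv. ring.
Qed.

(** This is the quotient of an odd partial product by the preceding even one; its limit 1 extends
    convergence to all indices. *)
Lemma is_Clim_seq_odd_factor (x : C) :
  is_Clim_seq (fun n => tGamma_factor x (S (2 * n))) 1.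
Proof.
  assert (Hu : is_lim_seq (fun n => / INR (S (2 * n))) 0).
  { apply (is_lim_seq_le_le (fun _ => 0) _ (fun n => 1 / INR (S n)));
      [|apply is_lim_seq_const|apply is_lim_seq_div_S].
    intros n. assert (0 < INR (S n)) by (apply lt_0_INR; lia).
    assert (INR (S n) <= INR (S (2 * n))) by (apply le_INR; lia).
    unfold Rdiv. rewrite Rmult_1_l. split.
    - apply Rlt_le, Rinv_0_lt_compat. lra.
    - apply Rinv_le_contravar; lra. }
  apply is_Clim_seq_ext with
    (fun n => Cexp (- x * RtoC (/ INR (S (2 * n)))) * (1 + x * RtoC (/ INR (S (2 * n)))))%C.
  { intros n. unfold tGamma_factor, tGamma_base.
    rewrite Nat.odd_succ, Nat.even_mul. simpl (Nat.even 2 || Nat.even n)%bool. cbv iota.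
    rewrite RtoC_inv by (apply not_0_INR; lia).
    unfold Cdiv. do 2 f_equal. ring. }
  assert (E : (Cexp (- x * RtoC 0) * 1)%C = 1) by (rewrite Cmult_0_r, Cexp_0; ring).
  refine (eq_ind _ (is_Clim_seq _) _ _ E).
  apply (is_Clim_seq_mult (fun n => Cexp (- x * RtoC (/ INR (S (2 * n)))))).
  - now apply is_Clim_seq_Cexp.
  - apply is_Clim_seq_bound with (fun n => Cmod x * / INR (S (2 * n))).
    + intros n. replace (1 + x * RtoC (/ INR (S (2 * n))) - 1)%C
        with (x * RtoC (/ INR (S (2 * n))))%C by ring.
      rewrite Cmod_mult, Cmod_R, Rabs_pos_eq; [lra|].
      apply Rlt_le, Rinv_0_lt_compat, lt_0_INR. lia.
    + replace (Finite 0) with (Finite (Cmod x * 0)) by (f_equal; ring).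
      apply is_lim_seq_mult'; [apply is_lim_seq_const|exact Hu].
Qed.

Lemma is_Cprod_inf_tGamma (x : C) : 0 < Re x ->
  is_Cprod_inf (tGamma_factor x) (Cexp (- x * ln 2) * (x / 2 * J (x / 2 - 1)))%C.
Proof.
  intros Hx. apply is_Clim_seq_filterlim.
  set (l := (Cexp (- x * ln 2) * (x / 2 * J (x / 2 - 1)))%C).
  assert (He : is_Clim_seq (fun n => Cprod (tGamma_factor x) (2 * n)) l).
  { apply is_Clim_seq_ext with (fun n => Cexp (- x * alt_harmonic n) * pair_prod x n)%C.
    - intros n. now rewrite Cprod_even by easy.
    - apply (is_Clim_seq_mult (fun n => Cexp (- x * alt_harmonic n))).
      + apply is_Clim_seq_Cexp, is_lim_seq_alt_harmonic.
      + now apply is_Clim_seq_pair_prod. }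
  apply is_Clim_seq_even_odd; [exact He|].
  replace l with (l * 1)%C by ring.
  exact (is_Clim_seq_mult _ _ _ _ He (is_Clim_seq_odd_factor x)).
Qed.

(** * The Beta function at second argument 1/2 *)

Lemma Rcpow_half (t : R) : 0 < t -> Rcpow t (1 / 2 - 1) = (/ RtoC (sqrt t))%C.
Proof.
  intros Ht. assert (Hq : 0 < sqrt t) by now apply sqrt_lt_R0.
  replace (1 / 2 - 1)%C with (- RtoC (/ 2))%C by (rewrite RtoC_inv by lra; field).
  unfold Rcpow. rewrite <- RtoC_inv by lra.
  replace (- RtoC (/ 2) * RtoC (ln t))%C with (RtoC (- ln (sqrt t))).
  - unfold Cexp. simpl Re. simpl Im. rewrite sin_0, cos_0, exp_Ropp, exp_ln by easy.
    unfold RtoC. f_equal; ring.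
  - rewrite <- RtoC_opp, <- RtoC_mult. f_equal.
    rewrite <- (sqrt_sqrt t) at 2 by lra. rewrite ln_mult by easy. field.
Qed.

Lemma Beta_half (a : C) : 0 < Re a -> Beta a (1 / 2) = J (a - 1).
Proof.
  intros Ha.
  assert (H : -1 < Re (a - 1)) by (destruct a; unfold Re in *; simpl in *; lra).
  assert (HB : is_RInt_gen (V := C_R_NormedModule)
    (fun t => Rcpow t (a - 1) * Rcpow (1 - t)%R (1 / 2 - 1))%C
    (at_right 0) (at_left 1) (J (a - 1))).
  { refine (is_RInt_gen_01_ext (V := C_R_NormedModule) _ _ _ _ (J_correct _ H)).
    intros t Ht. rewrite Rcpow_half by lra. reflexivity. }
  exact (is_RInt_gen_unique (V := C_R_CompleteNormedModule) (Fa := at_right 0)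
    (Fb := at_left 1) _ _ HB).
Qed.

Open Scope C_scope.

(** The existence clauses guarantee that the total operators [Cprod_inf] and [CInt01] return genuine
    limits here. *)
Theorem theorem2p3 (x : C) (hx : (0 < Re x)%R) :
  ex_Cprod_inf (tGamma_factor x) /\
  ex_CInt01 (fun t : R => Rcpow t (x / 2 - 1) / RtoC (sqrt (1 - t))) /\
  tGamma x = 1 / 2 * Beta (x / 2) (1 / 2) /\
  1 / 2 * Beta (x / 2) (1 / 2) =
    1 / 2 * CInt01 (fun t : R => Rcpow t (x / 2 - 1) / RtoC (sqrt (1 - t))).
Proof.
  assert (Ha := Re_half_pos x hx).
  assert (Hs : (-1 < Re (x / 2 - 1))%R)
    by (destruct (x / 2); unfold Re in *; simpl in *; lra).
  assert (HP := is_Cprod_inf_tGamma x hx).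
  rewrite (Beta_half _ Ha).
  split; [eexists; exact HP|].
  split; [exact (ex_CInt01_beta_kernel _ Hs)|].
  split; [|reflexivity].
  assert (E : Cprod_inf (tGamma_factor x) = Cexp (- x * ln 2) * (x / 2 * J (x / 2 - 1)))
    by exact (iota_filterlim_locally (V := C_R_CompleteNormedModule) _ _ HP).
  unfold tGamma. rewrite E.
  assert (Hx : x <> 0).
  { intros E0. rewrite E0, re_RtoC in hx. lra. }
  (* The prefactor 2^x cancels the 2^(-x) left by the product, and (1/x)(x/2) leaves the 1/2. *)
  transitivity (1 / x * (x / 2 * J (x / 2 - 1)) * (Cexp (x * ln 2) * Cexp (- (x * ln 2)))).
  - replace (- (x * ln 2)) with (- x * ln 2) by ring. ring.
  - rewrite Cexp_opp_r. field. exact Hx.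
Qed.
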